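(* Let $T\subset\mathbb R^2$ be a nondegenerate triangle and let $$U_2(T):=\bigl\{v\in U_3(T):\ \partial_nv|_e\in\mathbb P_1(e)\ \text{ for every edge }e\text{ of }T\bigr\},$$ where $U_3(T)=\mathbb P_3(T)+\operatorname{span}\{w_0,w_1,w_2\}$ with $w_i$ as in the context. A function $v\in U_2(T)$ is uniquely determined by the vertex degrees of freedom $v(\mathtt v)$ and $\nabla v(\mathtt v)$, where $\mathtt v$ runs over the three vertices of $T$; that is, these nine functionals are unisolvent for $U_2(T)$.
   Context: $T$ has vertices $\mathtt v_0,\mathtt v_1,\mathtt v_2$, area $|T|$ and barycenter $\mathtt v_c=(\mathtt v_0+\mathtt v_1+\mathtt v_2)/3$. The barycentric refinement splits $T$ into subtriangles $T_0,T_1,T_2$, where $T_i$ is the convex hull of $\mathtt v_c$ and the two vertices $\mathtt v_j$, $j\ne i$. $\lambda_i$ is the barycentric coordinate of $T$ associated with $\mathtt v_i$; $\lambda_i^{\rm R}$ is the continuous function on $T$, affine on each $T_j$, with $\lambda_i^{\rm R}(\mathtt v_i)=1$ and value $0$ at $\mathtt v_c$ and at the other two vertices. Indices $i\in\{0,1,2\}$ are understood modulo 3. $e_i$ is the edge opposite to $\mathtt v_i$ with a fixed unit normal $\boldsymbol n_i$, $\partial_n$ on $e_i$ is the derivative in direction $\boldsymbol n_i$, $c_{i,i}=\nabla\lambda_i\cdot\boldsymbol n_i$, and $C_T=4|T|^2/9$. $\mathbb P_m$ denotes polynomials of degree at most $m$. The functions (all in $C^1(T)$) are $$v_{i,i+1}=\tfrac{C_T}{2}\bigl[(\lambda_i^{\rm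 R})^2-\lambda_i^2\bigr](\lambda_{i-1}-\lambda_{i+1})-C_T\lambda_0\lambda_1\lambda_2,\qquad v_{i,i-1}=\tfrac{C_T}{2}\bigl[(\lambda_i^{\rm R})^2-\lambda_i^2\bigr](\lambda_{i-1}-\lambda_{i+1})+C_T\lambda_0\lambda_1\lambda_2,$$ $$w_i=\frac{1}{4C_Tc_{i,i}}\bigl(v_{i+1,i}-v_{i-1,i}\bigr),\qquad i=0,1,2.$$ *)

(* Defs.v *)
From HB Require Import structures.
From mathcomp Require Import all_boot all_order all_algebra.
From mathcomp Require Import all_classical all_reals all_analysis.
(* The notations of mpoly clash with those of MathComp-Analysis. *)
From mathcomp Require mpoly.
Import -(notations) mpoly.

Set Implicit Arguments.
Unset Strict Implicit.
Unset Printing Implicit Defensive.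

Import Order.TTheory GRing.Theory Num.Theory.
Import numFieldNormedType.Exports.
Local Open Scope classical_set_scope.
Local Open Scope ring_scope.

(* A function on a set [A] of the plane is represented by a function on the
   whole plane whose values off [A] are irrelevant. *)

Section Plane.
Context {R : realType}.
Notation plane := 'rV[R]_2.
Implicit Types (A : set plane) (f : plane -> R).

Definition dot (x y : plane) : R := \sum_(j < 2) x 0 j * y 0 j.

Definition conv_hull A : set plane := smallest (@convex_set R plane) A.

(* [msize p] is 1 + the total degree of [p], and 0 if [p = 0]. *)
Definition poly_on A (m : nat) f : Prop :=
  exists p : mpoly 2 R,
    (msize p <= m.+1)%N /\
    forall x, A x -> f x = meval (x 0) p.

(* The differential is taken relative to [A]: for a function in C^1(A) it is,
   also at boundary points of [A], the continuous extension of the gradient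
   in the interior. *)
Definition grad A f (x : plane) : plane :=
  \row_(j < 2) 'd f (within A (nbhs x)) (delta_mx 0 j).

(* [dofs] is unisolvent for the function space [U] on [A]. *)
Definition unisolvent (I : finType) A (U : set (plane -> R))
    (dofs : I -> (plane -> R) -> R) : Prop :=
  forall a : I -> R,
    exists u, [/\ U u, forall k, dofs k u = a k &
      forall u', U u' -> (forall k, dofs k u' = a k) ->
        forall x, A x -> u' x = u x].

End Plane.

(* Indices live in the ring 'I_3 = Z/3Z, so [i + 1] and [i - 1] are mod 3. *)
Section Triangle.
Context {R : realType} (vtx : 'I_3 -> 'rV[R]_2).
Notation plane := 'rV[R]_2.

Definition edge_mx : 'M[R]_2 := col_mx (vtx 1 - vtx 0) (vtx (1 + 1) - vtx 0).

Definition nondegenerate_triangle : Prop := row_free edge_mx.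

Definition area : R := `|\det edge_mx| / 2.

Definition triangle : set plane := conv_hull (range vtx).

Definition barycenter : plane := 3^-1 *: \sum_i vtx i.

Definition opp_edge (i : 'I_3) : set plane :=
  conv_hull (vtx @` [set j | j != i]).

Definition subtriangle (i : 'I_3) : set plane :=
  conv_hull (barycenter |` vtx @` [set j | j != i]).

Definition unit_normal (i : 'I_3) (n : plane) : Prop :=
  dot n n = 1 /\ dot n (vtx (i + 1) - vtx (i - 1)) = 0.

Definition barycentric (lam : 'I_3 -> plane -> R) : Prop :=
  forall i, poly_on triangle 1 (lam i) /\
            forall j, lam i (vtx j) = (i == j)%:R.

Definition refined_hat (lamR : 'I_3 -> plane -> R) : Prop :=
  forall i, [/\ {within triangle, continuous (lamR i)},
                forall j, poly_on (subtriangle j) 1 (lamR i),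
                lamR i barycenter = 0 &
                forall j, lamR i (vtx j) = (i == j)%:R].

Section Spaces.
Variables (n : 'I_3 -> plane) (lam lamR : 'I_3 -> plane -> R).

Definition C_T : R := 4 * area ^+ 2 / 9.

(* [lam i] is affine, so its gradient may be taken at any point. *)
Definition c_diag (i : 'I_3) : R :=
  dot (grad triangle (lam i) barycenter) (n i).

(* Meaningful for [j = i + 1] and [j = i - 1] only. *)
Definition v_fun (i j : 'I_3) (x : plane) : R :=
  let b := C_T * lam 0 x * lam 1 x * lam (1 + 1) x in
  C_T / 2 * (lamR i x ^+ 2 - lam i x ^+ 2) * (lam (i - 1) x - lam (i + 1) x)
  + (if j == i + 1 then - b else b).

Definition w_fun (i : 'I_3) (x : plane) : R :=
  (4 * C_T * c_diag i)^-1 * (v_fun (i + 1) i x - v_fun (i - 1) i x).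

Definition U3 : set (plane -> R) := [set u |
  exists (p : plane -> R) (a : 'I_3 -> R), poly_on triangle 3 p /\
    forall x, triangle x -> u x = p x + \sum_i a i * w_fun i x].

Definition U2 : set (plane -> R) := [set u | U3 u /\
  forall i, poly_on (opp_edge i) 1 (fun x => dot (grad triangle u x) (n i))].

End Spaces.

(* [(i, None)] is the value at vertex [i], and [(i, Some j)] is the [j]-th
   component of the gradient there. *)
Definition vertex_dof (k : 'I_3 * option 'I_2) (u : plane -> R) : R :=
  if k.2 is Some j then grad triangle u (vtx k.1) 0 j else u (vtx k.1).

End Triangle.

(* Main.v *)
Require Import Defs.
From HB Require Import structures.
From mathcomp Require Import all_boot all_order all_algebra.
From mathcomp Require Import all_classical all_reals all_analysis.
From mathcomp Require Import ring lra.
From mathcomp Require mpoly.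
Import -(notations) mpoly.

(** Why the nine functionals are unisolvent.

    Let m be the minimum of the three barycentric coordinates.  On [T] the
    refined hat function is lambda_i - m, because the subtriangle T_j is where
    lambda_j is the smallest coordinate ([refined_hatE]).  Substituting this
    turns c_ii w_i into an explicit polynomial expression [hct] in the lambda's
    and m ([w_funE]), which satisfies sum_i c_ii w_i = (3/2) b for the cubic
    bubble b ([sum_hct]).  Cubic polynomials are the combinations of the nine
    products lambda_i^2 lambda_j and of b ([poly_on3_bary]), so on [T] the
    elements of U_3 are the functions [spline d c a] with nine coefficients [d],
    the coefficient [c] of b and the coefficients [a] of the functions c_ii w_i.

    The functions b and w_i vanish to second order at the vertices, and the
    values and gradients there correspond one to one to the coefficients [d]
    ([spline_dofP]).

    Along the edge e_k, the normal derivative of [spline d c a] is a quadratic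
    polynomial.  The functions b and c_ii w_i contribute only multiples of the
    edge bump lambda_(k+1) lambda_(k-1), with a factor 1 for b and for i = k and
    a factor 1/4 for i <> k ([has_diff_hct]).  Hence the normal derivative is
    affine on e_k exactly when

      c + (3 a_k + sum_i a_i) / 4 = r_k,

    where r_k depends on [d] only ([normal_derivP]).  Given [d], these three
    equations for [c] and [a] are solvable, and two solutions differ by a
    multiple of c = - 3/2, a_0 = a_1 = a_2 = 1, which is the relation
    sum_i c_ii w_i = (3/2) b: the function on [T] is unique.

    All differentials are computed from quadratic error bounds ([has_diff]);
    these also hold for the products with m in w_i, although m itself is not
    differentiable at the vertices ([has_diff_min]).  [diff_within] links them
    to the differential relative to [T]. *)

Set Implicit Arguments.
Unset Strict Implicit.
Unset Printing Implicit Defensive.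

Import Order.TTheory GRing.Theory Num.Theory.
Import numFieldNormedType.Exports.
Local Open Scope classical_set_scope.
Local Open Scope ring_scope.

(** * Indices modulo 3 *)

Lemma cyc_predK (i : 'I_3) : i - 1 + 1 = i.
Proof. by apply/val_inj; case: i => [[|[|[|//]]] p]. Qed.

Lemma cyc_succK (i : 'I_3) : i + 1 - 1 = i.
Proof. by apply/val_inj; case: i => [[|[|[|//]]] p]. Qed.

Lemma cyc_pred2 (i : 'I_3) : i - 1 - 1 = i + 1.
Proof. by apply/val_inj; case: i => [[|[|[|//]]] p]. Qed.

Lemma cyc_succ2 (i : 'I_3) : i + 1 + 1 = i - 1.
Proof. by apply/val_inj; case: i => [[|[|[|//]]] p]. Qed.

Lemma cyc_eqF (i : 'I_3) :
  ((i + 1 == i) = false) * ((i == i + 1) = false) *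
  ((i - 1 == i) = false) * ((i == i - 1) = false) *
  ((i - 1 == i + 1) = false) * ((i + 1 == i - 1) = false).
Proof. by case: i => [[|[|[|//]]] p]. Qed.

Lemma cyc_case (k i : 'I_3) : [\/ i = k, i = k + 1 | i = k - 1].
Proof.
have : [|| i == k, i == k + 1 | i == k - 1].
  by case: i => [[|[|[|//]]] p]; case: k => [[|[|[|//]]] q].
by case/or3P=> /eqP; constructor.
Qed.

Lemma sum_cyc (V : nmodType) (k : 'I_3) (F : 'I_3 -> V) :
  \sum_i F i = F k + F (k + 1) + F (k - 1).
Proof.
rewrite (bigD1 k) //= (bigD1 (k + 1)) ?cyc_eqF //= (bigD1 (k - 1)) ?cyc_eqF //=.
rewrite big1 ?addr0 ?addrA // => i /andP[/andP[h1 h2] h3].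
by case: (cyc_case k i) h1 h2 h3 => ->; rewrite ?eqxx.
Qed.

Lemma natbE (R : pzSemiRingType) :
  ((true%:R = 1 :> R) * (false%:R = 0 :> R))%type.
Proof. by []. Qed.

(** This form of a sum of functions lets [big_ind] carry over closure under
    addition. *)
Lemma sum_funE (I : finType) (S : Type) (V : nmodType) (F : I -> S -> V) :
  (fun x => \sum_i F i x) =
  \big[(fun f g x => f x + g x)/(fun=> 0)]_i F i.
Proof. by apply/funext => x; elim/big_ind2 : _ => // _ f _ g <- <-. Qed.

(** * Linear forms on the plane *)

Section LinearForm.
Context {R : realType}.
Notation plane := 'rV[R]_2.
Implicit Types (x h : plane) (L : plane -> R).

Definition linear_form L :=
  forall (a : R) h k, L (a *: h + k) = a * L h + L k.

Lemma linear_form0 L : linear_form L -> L 0 = 0.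
Proof. by move=> /(_ 1 0 0); rewrite scale1r addr0 => e; lra. Qed.

Lemma linear_formD L h k : linear_form L -> L (h + k) = L h + L k.
Proof. by move=> /(_ 1 h k); rewrite scale1r mul1r. Qed.

Lemma linear_formZ L a h : linear_form L -> L (a *: h) = a * L h.
Proof. by move=> lL; have := lL a h 0; rewrite linear_form0 ?addr0. Qed.

Lemma linear_formB L h k : linear_form L -> L (h - k) = L h - L k.
Proof.
by move=> lL; rewrite linear_formD // -scaleN1r linear_formZ // mulN1r.
Qed.

Lemma linear_form_sum L (I : finType) (c : I -> R) (v : I -> plane) :
  linear_form L -> L (\sum_i c i *: v i) = \sum_i c i * L (v i).
Proof.
move=> lL; elim/big_ind2 : _ => [|a b c' d <- <-|i _].
- exact: linear_form0.
- by rewrite linear_formD.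
- by rewrite linear_formZ.
Qed.

Lemma linear_formE L h : linear_form L ->
  L h = \sum_j h 0 j * L (delta_mx 0 j).
Proof. by move=> lL; rewrite {1}(row_sum_delta h) linear_form_sum. Qed.

Lemma ler_coord h j : `|h 0 j| <= `|h|.
Proof.
rewrite [leRHS]/Num.Def.normr /= mx_normrE.
by apply/bigmax_geP; right => /=; exists (0, j).
Qed.

Lemma linear_form_bounded L : linear_form L ->
  exists2 K, 0 <= K & forall h, `|L h| <= K * `|h|.
Proof.
move=> lL; exists (\sum_j `|L (delta_mx 0 j)|); first by rewrite sumr_ge0.
move=> h; rewrite linear_formE // mulr_suml (le_trans (ler_norm_sum _ _ _)) //.
by apply: ler_sum => j _; rewrite normrM mulrC ler_wpM2l // ler_coord.
Qed.

Lemma linear_form_continuous L : linear_form L -> continuous L.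
Proof.
move=> lL x.
pose c i := L (delta_mx 0 i).
have -> : L = fun h => h 0 0 * c 0 + h 0 1 * c 1.
  apply/funext => h; rewrite linear_formE // !big_ord_recl big_ord0 addr0.
  by congr (_ + h 0 _ * L (delta_mx 0 _)); apply/val_inj.
have ct i : (fun h : plane => h 0 i * c i) @ x --> x 0 i * c i.
  exact: (@cvgMr_tmp R plane (nbhs x) _ _ _ _
    (@coord_continuous R 1 2 0 i x)).
exact: (@cvgD R R^o plane (nbhs x) _ _ _ _ _ (ct 0) (ct 1)).
Qed.

End LinearForm.

(** * Differentials relative to a set *)

Section HasDiff.
Context {R : realType}.
Notation plane := 'rV[R]_2.
Implicit Types (A : set plane) (x y h : plane) (f g L : plane -> R).

(** A quadratic error bound is stronger than differentiability at [x] relative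
    to [A], but all the functions below have one, and it is stable under
    products by elementary estimates. *)
Definition has_diff A x f L := linear_form L /\
  exists C, forall y, A y -> `|y - x| <= 1 ->
    `|f y - f x - L (y - x)| <= C * `|y - x| ^+ 2.

(** The differential relative to [A] is a choice among the linear maps with a
    small-o error on [A].  It is pinned down because an error that is small
    along the segment from [x] to [y] forces two candidates to agree on
    [y - x], and these vectors determine a linear form. *)
Lemma diff_within A x f L : A x ->
  (forall y t, 0 <= t <= 1 -> A y -> A (t *: y + (1 - t) *: x)) ->
  (forall M, linear_form M -> (forall y, A y -> M (y - x) = 0) ->
    forall h, M h = 0) ->
  has_diff A x f L -> forall h, dot (grad A f x) h = L h.
Proof.
move=> Ax starA spanA [lL [C hC]] h.
set F := within A (nbhs x).
have FF : ProperFilter F.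
  by apply: within_nbhs_proper; apply: subset_closure.
have limF : lim F = x.
  by exact: (@cvg_lim plane (@norm_hausdorff R plane) plane F FF id x
    (@cvg_within plane (nbhs x) _ A)).
set Q := fun df : {linear plane -> R^o} => continuous df /\ forall y,
  f y = f (lim F) + df (y - lim F) +o_(y \near F) (y - lim F).
have QE (df : {linear plane -> R^o}) : Q df <-> continuous df /\
    forall e, 0 < e ->
      \forall y \near F, `|f y - (f x + df (y - x))| <= e * `|y - x|.
  have oP := @eqaddoP R plane R^o plane F f (fun y => f x + df (y - x))
    (fun y => y - x).
  rewrite /Q limF; split=> -[cd hd]; split=> //.
    by apply/oP; exact/funext.
  apply: (@eqaddoEx R plane R^o plane F f (fun y => f x + df (y - x)) _
    (fun y => y - x)) => y.
  have hE := (oP.2 hd).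
  exact: (congr1 (fun g => g y) hE).
have o_L e : 0 < e ->
    \forall y \near F, `|f y - (f x + L (y - x))| <= e * `|y - x|.
  move=> e0.
  have : nbhs x (ball x (Num.min 1 (e / (`|C| + 1)))).
    by apply: nbhsx_ballx; rewrite lt_min ltr01 divr_gt0 // ltr_wpDl.
  apply: filterS => y; rewrite -ball_normE /= => + Ay.
  rewrite distrC lt_min => /andP[/ltW y1 /ltW y2].
  rewrite opprD addrA (le_trans (hC _ Ay y1)) //.
  rewrite expr2 mulrA ler_wpM2r //.
  apply: (@le_trans _ _ ((`|C| + 1) * `|y - x|)).
    by rewrite ler_wpM2r // (le_trans (ler_norm C)) // lerDl.
  by move: y2; rewrite ler_pdivlMr ?ltr_wpDl // mulrC.
have /QE [_ o_d] : Q ('d f F).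
  apply: (@getPex _ Q).
  pose Ll : {linear plane -> R^o} :=
    HB.pack L (GRing.isLinear.Build _ _ _ _ L lL).
  by exists Ll; apply/QE; split; first exact: linear_form_continuous.
suff dE k : 'd f F k = L k.
  rewrite (linear_formE h lL); apply: eq_bigr => j _.
  by rewrite /grad mxE dE mulrC.
have lM : linear_form (fun k => 'd f F k - L k).
  move=> a u v.
  have -> : 'd f F (a *: u + v) = a * 'd f F u + 'd f F v by exact: linearP.
  by rewrite lL; ring.
apply/eqP; rewrite -subr_eq0; apply/eqP.
apply: (spanA _ lM) => y Ay; set M := fun k => 'd f F k - L k.
apply/eqP; rewrite -normr_le0 leNgt; apply/negP => Mz0; move: Mz0.
rewrite -/(M (y - x)); set z := y - x => Mz0.
(* With this tolerance the bound 2 * e * |z| stays below |M z| / 2. *)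
pose e := `|M z| / (`|z| + 1) / 4.
have z1 : 0 < `|z| + 1 by rewrite ltr_wpDl.
have e0 : 0 < e by rewrite !divr_gt0.
have : \forall y \near F, `|M (y - x)| <= 2 * e * `|y - x|.
  near=> w.
  have -> : M (w - x) =
    (f w - (f x + L (w - x))) - (f w - (f x + 'd f F (w - x))).
    by rewrite /M; ring.
  rewrite (le_trans (ler_normB _ _)) // [2 * e]mulr_natl mulr2n mulrDl lerD //.
    by near: w; exact: o_L.
  by near: w; exact: o_d.
move=> /nbhs_ballP [d /= d0 hd].
(* Shrinking z by t brings the point into the ball of radius d. *)
pose t := Num.min 1 (d / 2 / (`|z| + 1)).
have t0 : 0 < t by rewrite lt_min ltr01 !divr_gt0.
have t1 : t <= 1 by rewrite ge_min lexx.
have tzE : t *: y + (1 - t) *: x - x = t *: z.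
  by apply/rowP => j; rewrite !mxE; ring.
have : `|M (t *: z)| <= 2 * e * `|t *: z|.
  rewrite -tzE; apply: hd; last by apply: starA; rewrite // (ltW t0).
  rewrite -ball_normE /= distrC tzE normrZ gtr0_norm //.
  have : t <= d / 2 / (`|z| + 1) by rewrite ge_min lexx orbT.
  rewrite ler_pdivlMr // => ht.
  have : t * `|z| <= t * (`|z| + 1) by rewrite ler_pM2l // lerDl.
  by lra.
have -> : M (t *: z) = t * M z by exact: linear_formZ.
rewrite normrM normrZ (gtr0_norm t0) mulrCA ler_pM2l // => h1.
suff : 2 * e * `|z| < `|M z| by rewrite ltNge h1.
have -> : 2 * e * `|z| = `|M z| * (`|z| / (`|z| + 1) / 2).
  by rewrite /e; field; rewrite gt_eqF.
rewrite gtr_pMr // ltr_pdivrMr // ltr_pdivrMr //.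
by have := normr_ge0 z; lra.
Unshelve. all: by end_near.
Qed.
Lemma has_diff_eq A x f g L L' : A x -> (forall y, A y -> f y = g y) ->
  L =1 L' -> has_diff A x f L -> has_diff A x g L'.
Proof.
move=> Ax fg LL' [lL [C hC]]; split.
  by move=> a h k; rewrite -!LL'.
by exists C => y Ay y1; rewrite -!fg // -LL'; exact: hC.
Qed.

Lemma has_diff_affine A x f L : linear_form L ->
  (forall y, f y - f x = L (y - x)) -> has_diff A x f L.
Proof.
move=> lL hf; split=> //; exists 0 => y _ _.
by rewrite hf subrr normr0 mul0r.
Qed.

Lemma has_diff_cst A x (c : R) : has_diff A x (fun=> c) (fun=> 0).
Proof.
apply: has_diff_affine => [a h k|y]; first by rewrite mulr0 addr0.
by rewrite subrr.
Qed.

Lemma has_diffD A x f g L L' : has_diff A x f L -> has_diff A x g L' ->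
  has_diff A x (fun y => f y + g y) (fun h => L h + L' h).
Proof.
move=> [lL [C hC]] [lL' [C' hC']]; split.
  by move=> a h k; rewrite lL lL'; ring.
exists (C + C') => y Ay y1.
have -> : f y + g y - (f x + g x) - (L (y - x) + L' (y - x)) =
  (f y - f x - L (y - x)) + (g y - g x - L' (y - x)) by ring.
by rewrite (le_trans (ler_normD _ _)) // mulrDl lerD ?hC ?hC'.
Qed.

Lemma has_diff_lip A x f L : has_diff A x f L ->
  exists2 K, 0 <= K &
    forall y, A y -> `|y - x| <= 1 -> `|f y - f x| <= K * `|y - x|.
Proof.
move=> [lL [C hC]]; have [K K0 hK] := linear_form_bounded lL.
exists (K + `|C|) => [|y Ay y1]; first by rewrite addr_ge0.
have -> : f y - f x = L (y - x) + (f y - f x - L (y - x)) by ring.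
rewrite (le_trans (ler_normD _ _)) // mulrDl lerD //.
rewrite (le_trans (hC _ Ay y1)) // expr2 mulrA ler_wpM2r //.
apply: (@le_trans _ _ (`|C| * `|y - x|)).
  by rewrite ler_wpM2r // ler_norm.
by rewrite ler_piMr.
Qed.

Lemma has_diffM A x f g L L' : has_diff A x f L -> has_diff A x g L' ->
  has_diff A x (fun y => f y * g y) (fun h => f x * L' h + g x * L h).
Proof.
move=> df dg; have [K K0 hK] := has_diff_lip df.
have [K' K0' hK'] := has_diff_lip dg.
case: df dg => [lL [C hC]] [lL' [C' hC']]; split.
  by move=> a h k; rewrite lL lL'; ring.
exists (`|f x| * C' + `|g x| * C + K * K') => y Ay y1.
have -> : f y * g y - f x * g x - (f x * L' (y - x) + g x * L (y - x)) =
  f x * (g y - g x - L' (y - x)) + g x * (f y - f x - L (y - x))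
  + (f y - f x) * (g y - g x) by ring.
rewrite (le_trans (ler_normD _ _)) // [leRHS]mulrDl lerD //.
  rewrite (le_trans (ler_normD _ _)) // !normrM [leRHS]mulrDl lerD // -mulrA.
    by rewrite ler_wpM2l // hC'.
  by rewrite ler_wpM2l // hC.
rewrite normrM (_ : _ * _ ^+ 2 = K * `|y - x| * (K' * `|y - x|)); last by ring.
by rewrite ler_pM // ?hK ?hK'.
Qed.

Lemma has_diffZ A x (c : R) f L : has_diff A x f L ->
  has_diff A x (fun y => c * f y) (fun h => c * L h).
Proof.
move=> df; have [lL [C hC]] := df; split.
  by move=> a h k; rewrite lL; ring.
exists (`|c| * C) => y Ay y1.
by rewrite -!mulrBr normrM -mulrA ler_wpM2l // hC.
Qed.

Lemma has_diff_sum A x (I : finType) (f L : I -> plane -> R) :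
  (forall i, has_diff A x (f i) (L i)) ->
  has_diff A x (fun y => \sum_i f i y) (fun h => \sum_i L i h).
Proof.
move=> df; rewrite !sum_funE; elim/big_ind2 : _ => // [|f1 L1 f2 L2 h1 h2].
  exact: has_diff_cst.
exact: has_diffD.
Qed.

End HasDiff.

(** * Convex hulls and barycentric coordinates *)

Section ConvexHull.
Context {R : realType}.
Notation plane := 'rV[R]_2.
Implicit Types A B : set plane.

Lemma conv_hull_sub A : A `<=` conv_hull A.
Proof. exact: sub_gen_smallest. Qed.

Lemma conv_hull_seg A (x y : plane) (t : R) : 0 <= t <= 1 ->
  conv_hull A x -> conv_hull A y -> conv_hull A (t *: x + (1 - t) *: y).
Proof.
move=> /andP[t0 t1] Ax Ay B [cB AB].
have it : Itv.spec (@Itv.num_sem R) (Itv.Real `[0%Z, 1%Z]) t.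
  by apply/and3P; split => //=; rewrite ?ger0_real// in_itv /= t0 t1.
have /(_ x y (Itv.mk it)) := cB.
by rewrite !inE; apply; [exact: Ax|exact: Ay].
Qed.

Lemma conv_hull_min A B :
  (forall x y t, 0 <= t <= 1 -> B x -> B y -> B (t *: x + (1 - t) *: y)) ->
  A `<=` B -> conv_hull A `<=` B.
Proof.
move=> cB AB; apply: smallest_sub => // x y l; rewrite !inE => Bx By.
by apply: cB => //; rewrite ge0 /=.
Qed.

Lemma conv_hull3 A (p q r : plane) (a b c : R) :
  conv_hull A p -> conv_hull A q -> conv_hull A r ->
  0 <= a -> 0 <= b -> 0 <= c -> a + b + c = 1 ->
  conv_hull A (a *: p + b *: q + c *: r).
Proof.
move=> Ap Aq Ar a0 b0 c0 s.
have [c1|c1] := eqVneq c 1.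
  have [-> ->] : a = 0 /\ b = 0 by split; lra.
  by rewrite c1 !scale0r scale1r !add0r.
have c1' : 1 - c != 0 by rewrite subr_eq0 eq_sym.
have c_lt : 0 < 1 - c by rewrite lt_neqAle eq_sym c1' /=; lra.
have -> : a *: p + b *: q + c *: r =
   (1 - c) *: ((a / (1 - c)) *: p + (1 - a / (1 - c)) *: q)
   + (1 - (1 - c)) *: r.
  have -> : 1 - a / (1 - c) = b / (1 - c).
    by rewrite (_ : a = 1 - c - b); [field|lra].
  rewrite scalerDr !scalerA [(1 - c) * (a / _)]mulrC.
  rewrite [(1 - c) * (b / _)]mulrC !divfK //.
  by congr (_ + _ *: _); ring.
apply: conv_hull_seg => //; first by apply/andP; split; lra.
apply: conv_hull_seg => //; apply/andP; split.
  by rewrite divr_ge0 // ltW.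
by rewrite ler_pdivrMr //; lra.
Qed.

End ConvexHull.

Section Coordinates.
Context {R : realType}.
Notation plane := 'rV[R]_2.
Variable vtx : 'I_3 -> plane.

(** The differential of the [i]-th barycentric coordinate: the coordinates of
    [h] in the basis of the two edge vectors at vertex 0 are the increments of
    lambda_1 and lambda_2. *)
Definition bary_form (i : 'I_3) (h : plane) : R :=
  let c := h *m invmx (edge_mx vtx) in
  if i == 0 then - c 0 0 - c 0 1 else if i == 1 then c 0 0 else c 0 1.

Definition bary (i : 'I_3) (x : plane) : R :=
  (i == 0)%:R + bary_form i (x - vtx 0).

Lemma linear_bary_form i : linear_form (bary_form i).
Proof.
move=> a h k; rewrite /bary_form mulmxDl -scalemxAl !mxE.
by case: ifP => _; [ring|case: ifP].
Qed.

Lemma sum_bary_form h : \sum_i bary_form i h = 0.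
Proof. by rewrite (sum_cyc 0) /bary_form /=; ring. Qed.

Lemma bary_sub i x y : bary i y - bary i x = bary_form i (y - x).
Proof.
have -> : y - x = (y - vtx 0) - (x - vtx 0) by rewrite opprB addrA subrK.
by rewrite (linear_formB _ _ (linear_bary_form i)) /bary; ring.
Qed.

Lemma sum_bary x : \sum_i bary i x = 1.
Proof.
by rewrite big_split /= sum_bary_form addr0 (sum_cyc 0) eqxx !cyc_eqF !addr0.
Qed.

Lemma bary_conv i (t : R) x y :
  bary i (t *: x + (1 - t) *: y) = t * bary i x + (1 - t) * bary i y.
Proof.
have -> : t *: x + (1 - t) *: y = y + t *: (x - y).
  by apply/rowP => j; rewrite !mxE; ring.
have := bary_sub i y (y + t *: (x - y)).
rewrite [y + _ - y]addrC addKr.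
rewrite (linear_formZ _ _ (linear_bary_form i)) -bary_sub => /eqP.
by rewrite subr_eq => /eqP ->; ring.
Qed.

Hypothesis hT : nondegenerate_triangle vtx.

Lemma edge_mx_unit : edge_mx vtx \in unitmx.
Proof. by rewrite -row_free_unit. Qed.

Lemma row_edge_mx :
  row 0 (edge_mx vtx) = vtx 1 - vtx 0 /\
  row 1 (edge_mx vtx) = vtx (1 + 1) - vtx 0.
Proof.
split; apply/rowP => j; rewrite mxE /edge_mx mxE;
  by case: splitP => t; rewrite !ord1 // => _; rewrite !mxE.
Qed.

Lemma bary_form_reproduce h : \sum_i bary_form i h *: vtx i = h.
Proof.
have [r0 r1] := row_edge_mx.
rewrite -[RHS](mulmxKV edge_mx_unit).
rewrite [h *m invmx (edge_mx vtx)]lock (sum_cyc 0) /bary_form -lock /=.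
set c := h *m _.
rewrite mulmx_sum_row !big_ord_recl big_ord0 addr0 r0.
have -> : lift ord0 ord0 = 1 :> 'I_2 by apply/val_inj.
rewrite r1.
have -> : 0 + 1 = 1 :> 'I_3 by apply/val_inj.
have -> : 0 - 1 = 1 + 1 :> 'I_3 by apply/val_inj.
have -> : ord0 = 0 :> 'I_2 by [].
by apply/rowP => j; rewrite !mxE; ring.
Qed.

Lemma bary_vtx i j : bary i (vtx j) = (i == j)%:R.
Proof.
have [r0 r1] := row_edge_mx.
have e1 : (vtx 1 - vtx 0) *m invmx (edge_mx vtx) = delta_mx 0 0.
  by rewrite -r0 -row_mul mulmxV ?edge_mx_unit // rowE mulmx1.
have e2 : (vtx (1 + 1) - vtx 0) *m invmx (edge_mx vtx) = delta_mx 0 1.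
  by rewrite -r1 -row_mul mulmxV ?edge_mx_unit // rowE mulmx1.
rewrite /bary /bary_form.
have [->|->|->] := cyc_case 0 j.
- rewrite subrr mul0mx !mxE.
  by case: i => [[|[|[|//]]] p] /=; rewrite !(oppr0, addr0).
- have -> : 0 + 1 = 1 :> 'I_3 by apply/val_inj.
  rewrite e1 !mxE /=.
  by case: i => [[|[|[|//]]] p] /=; rewrite !(oppr0, addr0, add0r, subrr).
- have -> : 0 - 1 = 1 + 1 :> 'I_3 by apply/val_inj.
  rewrite e2 !mxE /=.
  by case: i => [[|[|[|//]]] p] /=; rewrite !(oppr0, addr0, add0r, subrr).
Qed.

Lemma bary_reproduce x : \sum_i bary i x *: vtx i = x.
Proof.
rewrite /bary; under eq_bigr do rewrite scalerDl.
rewrite big_split /= bary_form_reproduce (sum_cyc 0) eqxx !cyc_eqF.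
by rewrite !scale0r !addr0 scale1r addrC subrK.
Qed.

Lemma triangleE : triangle vtx = [set x | forall i, 0 <= bary i x].
Proof.
apply/seteqP; split.
  apply: conv_hull_min.
    move=> x y t /andP[t0 t1] /= hx hy i; rewrite bary_conv.
    by rewrite addr_ge0 ?mulr_ge0 ?hx ?hy // subr_ge0.
  by move=> _ [j _ <-] i; rewrite bary_vtx ler0n.
move=> x hx; rewrite -(bary_reproduce x) (sum_cyc 0) /triangle.
apply: conv_hull3; rewrite -?(sum_cyc 0 (fun i => bary i x)) ?sum_bary //;
  by apply: conv_hull_sub; eexists.
Qed.

Lemma opp_edgeE k :
  opp_edge vtx k = [set x | triangle vtx x /\ bary k x = 0].
Proof.
rewrite triangleE; apply/seteqP; split.
  apply: conv_hull_min.
    move=> x y t /andP[t0 t1] /= [hx hx0] [hy hy0]; split.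
      move=> i; rewrite bary_conv.
      by rewrite addr_ge0 ?mulr_ge0 ?hx ?hy // subr_ge0.
    by rewrite bary_conv hx0 hy0 !mulr0 addr0.
  move=> _ [j /= jk <-]; split; first by move=> i; rewrite bary_vtx ler0n.
  by rewrite bary_vtx eq_sym (negPf jk).
move=> x /= [hx x0]; rewrite -(bary_reproduce x) (sum_cyc k) x0 scale0r add0r.
have := sum_bary x; rewrite (sum_cyc k) x0 add0r => s1.
have -> : bary (k - 1) x = 1 - bary (k + 1) x by lra.
apply: conv_hull_seg.
- have := hx (k + 1); have := hx (k - 1) => h1 h2.
  by apply/andP; split; lra.
- by apply: conv_hull_sub; exists (k + 1) => //=; rewrite cyc_eqF.
- by apply: conv_hull_sub; exists (k - 1) => //=; rewrite cyc_eqF.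
Qed.

(** If lambda_j is the smallest coordinate, then
    x = 3 lambda_j v_c + sum_(i <> j) (lambda_i - lambda_j) v_i
    is a convex combination. *)
Lemma subtriangle_mem j x : triangle vtx x ->
  (forall i, bary j x <= bary i x) -> subtriangle vtx j x.
Proof.
rewrite triangleE => /= hx hj.
have := sum_bary x; rewrite (sum_cyc j) => s1.
have -> : x = (3 * bary j x) *: barycenter vtx
    + (bary (j + 1) x - bary j x) *: vtx (j + 1)
    + (bary (j - 1) x - bary j x) *: vtx (j - 1).
  rewrite -[LHS]bary_reproduce /barycenter !(sum_cyc j) scalerA.
  rewrite mulrAC divff ?mul1r ?pnatr_eq0//.
  by apply/rowP => l; rewrite !mxE; ring.
apply: conv_hull3; rewrite ?mulr_ge0 ?subr_ge0 //; last by lra.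
- by apply: conv_hull_sub; left.
- by apply: conv_hull_sub; right; exists (j + 1) => //=; rewrite cyc_eqF.
- by apply: conv_hull_sub; right; exists (j - 1) => //=; rewrite cyc_eqF.
Qed.

Local Notation T := (triangle vtx).

Lemma triangle_ge0 i x : T x -> 0 <= bary i x.
Proof. by rewrite triangleE. Qed.

Lemma vtx_triangle i : T (vtx i).
Proof. by apply: conv_hull_sub; exists i. Qed.

Lemma grad_triangle x f L h : T x -> has_diff T x f L ->
  dot (grad T f x) h = L h.
Proof.
move=> Tx dfL; apply: diff_within dfL h => // [y t ht Ty|M lM M0 h].
  by apply: conv_hull_seg.
rewrite -(bary_form_reproduce h) linear_form_sum //.
have MvE i : M (vtx i) = M x.
  have := M0 _ (vtx_triangle i).
  by rewrite linear_formB // => e; lra.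
by under eq_bigr do rewrite MvE; rewrite -mulr_suml sum_bary_form mul0r.
Qed.

Lemma has_diff_bary x i : has_diff T x (bary i) (bary_form i).
Proof.
by apply: has_diff_affine => [|y]; [exact: linear_bary_form|exact: bary_sub].
Qed.

Lemma bary_form_vtx i j k :
  bary_form i (vtx j - vtx k) = (i == j)%:R - (i == k)%:R.
Proof. by rewrite -bary_sub !bary_vtx. Qed.

Lemma sum_scale_bary (a : 'I_3 -> R) j : \sum_i a i * bary i (vtx j) = a j.
Proof.
by rewrite (sum_cyc j) !bary_vtx eqxx !cyc_eqF !natbE; ring.
Qed.

Lemma bary_barycenter i : bary i (barycenter vtx) = 3^-1.
Proof.
have : bary_form i (\sum_j 3^-1 *: (vtx j - vtx i)) = 3^-1 - 1.
  rewrite (linear_form_sum _ _ (linear_bary_form i)) (sum_cyc i).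
  by rewrite !bary_form_vtx eqxx !cyc_eqF !natbE; field.
have -> : \sum_j 3^-1 *: (vtx j - vtx i) = barycenter vtx - vtx i.
  rewrite /barycenter !(sum_cyc i); by apply/rowP => j; rewrite !mxE; field.
by rewrite -bary_sub bary_vtx eqxx natbE => e; lra.
Qed.

Lemma barycenter_triangle : T (barycenter vtx).
Proof. by rewrite triangleE => i /=; rewrite bary_barycenter invr_ge0. Qed.

(** A vector orthogonal to grad lambda_k is parallel to the edge e_k, so it
    cannot be a unit normal of e_k. *)
Lemma unit_normal_neq0 k n : unit_normal vtx k n -> bary_form k n != 0.
Proof.
move=> [n1 n0]; apply/eqP => nk.
have sn := sum_bary_form n; rewrite (sum_cyc k) nk add0r in sn.
have nE : n = bary_form (k + 1) n *: (vtx (k + 1) - vtx (k - 1)).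
  rewrite -[LHS]bary_form_reproduce (sum_cyc k) nk scale0r add0r.
  have -> : bary_form (k - 1) n = - bary_form (k + 1) n by lra.
  by rewrite scaleNr -scalerBr.
have dotZ (c : R) (v w : plane) : dot v (c *: w) = c * dot v w.
  by rewrite /dot mulr_sumr; apply: eq_bigr => j _; rewrite mxE mulrCA.
by move: n1; rewrite {2}nE dotZ n0 mulr0 => /eqP; rewrite eq_sym oner_eq0.
Qed.

End Coordinates.

(** * Polynomials in barycentric coordinates *)

Section PolyOn.
Context {R : realType}.
Notation plane := 'rV[R]_2.
Implicit Types (A : set plane) (f g : plane -> R).

Lemma poly_onD A m f g : poly_on A m f -> poly_on A m g ->
  poly_on A m (fun x => f x + g x).
Proof.
move=> [p [sp fp]] [q [sq gq]]; exists (p + q); split.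
  by rewrite (leq_trans (mmeasureD_le _ _ _)) // geq_max sp sq.
by move=> x Ax; rewrite mevalD fp // gq.
Qed.

Lemma poly_onM A m m' f g : poly_on A m f -> poly_on A m' g ->
  poly_on A (m + m')%N (fun x => f x * g x).
Proof.
move=> [p [sp fp]] [q [sq gq]]; exists (p * q); split; last first.
  by move=> x Ax; rewrite mevalM fp // gq.
have [->|p0] := eqVneq p 0; first by rewrite mul0r mmeasure0.
have [->|q0] := eqVneq q 0; first by rewrite mulr0 mmeasure0.
rewrite msizeM // -subn1 leq_subLR (leq_trans (leq_add sp sq)) //.
by rewrite addSn addnS addnS.
Qed.

Lemma poly_on_cst A m (c : R) : poly_on A m (fun=> c).
Proof.
exists (mpolyC 2 c); split; last by move=> x _; rewrite mevalC.
by rewrite msizeC; case: eqP.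
Qed.

Lemma poly_onZ A m (c : R) f : poly_on A m f -> poly_on A m (fun x => c * f x).
Proof.
by move=> hf; have := poly_onM (poly_on_cst A 0 c) hf; rewrite add0n.
Qed.

Lemma poly_on_eq A m f g : (forall x, A x -> f x = g x) ->
  poly_on A m f -> poly_on A m g.
Proof.
by move=> fg [p [sp fp]]; exists p; split=> // x Ax; rewrite -fg // fp.
Qed.

Lemma poly_on_sum A m (I : finType) (f : I -> plane -> R) :
  (forall i, poly_on A m (f i)) -> poly_on A m (fun x => \sum_i f i x).
Proof.
move=> hf; rewrite sum_funE; elim/big_ind : _ => // [|f1 f2 h1 h2].
  exact: poly_on_cst.
exact: poly_onD.
Qed.

Lemma poly_on_coord A (j : 'I_2) : poly_on A 1 (fun x => x 0 j).
Proof.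
exists (mpolyX R (mnm1 j)); split; first by rewrite msizeX mdeg1.
by move=> x _; rewrite mevalXU.
Qed.

Lemma poly_on_linear A L : linear_form L -> poly_on A 1 L.
Proof.
move=> lL; apply: (@poly_on_eq _ _ (fun x => \sum_j L (delta_mx 0 j) * x 0 j)).
  move=> x _; rewrite (linear_formE x lL).
  by apply: eq_bigr => j _; rewrite mulrC.
by apply: poly_on_sum => j; apply: poly_onZ; exact: poly_on_coord.
Qed.

Lemma poly_on_ind A m f (P : (plane -> R) -> Prop) :
  P (fun=> 0) -> (forall g h, P g -> P h -> P (fun x => g x + h x)) ->
  (forall c g, P g -> P (fun x => c * g x)) ->
  (forall a b, (a + b <= m)%N -> P (fun x => x 0 0 ^+ a * x 0 1 ^+ b)) ->
  poly_on A m f -> exists2 g, P g & forall x, A x -> f x = g x.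
Proof.
move=> P0 PD PZ PX [p [sp fp]]; exists (fun x => meval (x 0) p) => //.
under eq_fun do rewrite mevalE.
have : {subset msupp p <= msupp p} by [].
elim: {1 3}(msupp p) => [|u s IH] sub_s.
  by under eq_fun do rewrite big_nil.
under eq_fun do rewrite big_cons.
apply: PD; last by apply: IH => v vs; apply: sub_s; rewrite inE vs orbT.
apply: PZ; under eq_fun do rewrite !big_ord_recl big_ord0 mulr1.
have -> : lift ord0 ord0 = 1 :> 'I_2 by apply/val_inj.
apply: PX.
have : (mdeg u < m.+1)%N.
  by apply: leq_trans sp; apply: msize_mdeg_lt; rewrite sub_s ?mem_head.
rewrite mdegE !big_ord_recl big_ord0 addn0 ltnS.
by have -> : lift ord0 ord0 = 1 :> 'I_2 by apply/val_inj.
Qed.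
End PolyOn.

Section PolyBary.
Context {R : realType}.
Notation plane := 'rV[R]_2.
Variable vtx : 'I_3 -> plane.
Hypothesis hT : nondegenerate_triangle vtx.
Local Notation bary := (bary vtx).
Local Notation bary_form := (bary_form vtx).

Lemma poly_on_bary A i : poly_on A 1 (bary i).
Proof.
apply: (@poly_on_eq _ _ _ (fun x => bary i 0 + bary_form i x)).
  by move=> x _; rewrite -[x in bary_form _ x]subr0 -bary_sub; ring.
apply: poly_onD; first exact: poly_on_cst.
exact/poly_on_linear/linear_bary_form.
Qed.

Lemma coord_bary (x : plane) j : x 0 j = \sum_i vtx i 0 j * bary i x.
Proof.
rewrite -[in LHS](bary_reproduce hT x) summxE; apply: eq_bigr => i _.
by rewrite !mxE mulrC.
Qed.

Lemma poly_on1_bary A f : poly_on A 1 f ->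
  exists a : 'I_3 -> R, forall x, A x -> f x = \sum_i a i * bary i x.
Proof.
pose P (f : plane -> R) :=
  exists a : 'I_3 -> R, f = fun x => \sum_i a i * bary i x.
move=> pf.
suff [g [a ->] fg] : exists2 g, P g & forall x, A x -> f x = g x.
  by exists a.
apply: poly_on_ind pf.
- by exists (fun=> 0); apply/funext => x; rewrite big1 // => i _; rewrite mul0r.
- move=> g h [a ->] [b ->]; exists (fun i => a i + b i); apply/funext => x.
  by rewrite -big_split; apply: eq_bigr => i _; rewrite mulrDl.
- move=> c g [a ->]; exists (fun i => c * a i); apply/funext => x.
  by rewrite mulr_sumr; apply: eq_bigr => i _; rewrite mulrA.
- have h0 : P (fun=> 1).
    exists (fun=> 1); apply/funext => x; rewrite -[LHS](sum_bary vtx x).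
    by apply: eq_bigr => i _; rewrite mul1r.
  move=> [|[|//]] [|[|//]] //= _.
  + by under eq_fun do rewrite !expr0 mulr1.
  + under eq_fun do rewrite expr0 mul1r expr1 coord_bary.
    by exists (fun i => vtx i 0 1).
  + under eq_fun do rewrite expr0 mulr1 expr1 coord_bary.
    by exists (fun i => vtx i 0 0).
Qed.

Definition bubble x := bary 0 x * bary 1 x * bary (1 + 1) x.

Lemma bubbleE k x : bubble x = bary k x * (bary (k + 1) x * bary (k - 1) x).
Proof.
rewrite /bubble.
have e1 : 0 + 1 = 1 :> 'I_3 by apply/val_inj.
have e2 : 1 + 1 = 0 - 1 :> 'I_3 by apply/val_inj.
by have [->|->|->] := cyc_case 0 k;
  rewrite ?cyc_succ2 ?cyc_succK ?cyc_predK ?cyc_pred2 ?e1 ?e2; ring.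
Qed.

Definition hermite_cubic (d : 'I_3 -> 'I_3 -> R) x : R :=
  \sum_i \sum_j d i j * (bary i x ^+ 2 * bary j x).

(** Every monomial of degree at most 3 is a product of three factors among 1,
    x_0 and x_1, all of which are linear combinations of the lambda's because
    sum_i lambda_i = 1; expanding leaves products of three lambda's. *)
Lemma poly_on3_bary A f : poly_on A 3 f ->
  exists d c, forall x, A x -> f x = hermite_cubic d x + c * bubble x.
Proof.
pose P (f : plane -> R) :=
  exists d c, f = fun x => hermite_cubic d x + c * bubble x.
move=> pf.
suff [g [d [c ->]] fg] : exists2 g, P g & forall x, A x -> f x = g x.
  by exists d, c.
have PD g h : P g -> P h -> P (fun x => g x + h x).
  move=> [a [c ->]] [b [c' ->]].
  exists (fun i j => a i j + b i j), (c + c'); apply/funext => x.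
  rewrite /hermite_cubic addrACA -big_split mulrDl; congr (_ + _).
  apply: eq_bigr => i _; rewrite -big_split.
  by apply: eq_bigr => j _; rewrite mulrDl.
have PZ c g : P g -> P (fun x => c * g x).
  move=> [a [c' ->]].
  exists (fun i j => c * a i j), (c * c'); apply/funext => x.
  rewrite mulrDr mulrA /hermite_cubic mulr_sumr; congr (_ + _).
  apply: eq_bigr => i _; rewrite mulr_sumr.
  by apply: eq_bigr => j _; rewrite mulrA.
have P0 : P (fun=> 0).
  exists (fun _ _ => 0), 0; apply/funext => x.
  rewrite /hermite_cubic big1 ?mul0r ?addr0 // => i _; rewrite big1 // => j _.
  by rewrite mul0r.
have Psum (F : 'I_3 -> plane -> R) :
    (forall i, P (F i)) -> P (fun x => \sum_i F i x).
  move=> PF; under eq_fun do rewrite (sum_cyc 0).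
  exact: (PD _ _ (PD _ _ (PF _) (PF _)) (PF _)).
have Pij i j : P (fun x => bary i x ^+ 2 * bary j x).
  exists (fun i' j' => ((i' == i) && (j' == j))%:R), 0; apply/funext => x.
  rewrite mul0r addr0 /hermite_cubic (bigD1 i) //= (bigD1 j) //= !eqxx mul1r.
  rewrite !big1 ?addr0 // => [k /negPf ki|k /negPf kj].
    by rewrite big1 // => l _; rewrite ki mul0r.
  by rewrite kj mul0r.
have Pb : P bubble.
  exists (fun _ _ => 0), 1; apply/funext => x.
  rewrite mul1r /hermite_cubic big1 ?add0r // => i _.
  by rewrite big1 // => j _; rewrite mul0r.
have P3 i j k : P (fun x => bary i x * bary j x * bary k x).
  have [<-|ij] := eqVneq i j; first by under eq_fun do rewrite -expr2.
  have [<-|ik] := eqVneq i k.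
    by under eq_fun do rewrite mulrAC -expr2.
  have [<-|jk] := eqVneq j k.
    by under eq_fun do rewrite -mulrA -expr2 mulrC.
  suff -> : (fun x => bary i x * bary j x * bary k x) = bubble by [].
  apply/funext => x; rewrite (bubbleE i).
  case: (cyc_case i j) ij jk => ->; case: (cyc_case i k) ik => ->;
    rewrite ?eqxx // => _ _ _; ring.
pose lin (f : plane -> R) :=
  exists a : 'I_3 -> R, forall x, f x = \sum_i a i * bary i x.
have Plin f1 f2 f3 : lin f1 -> lin f2 -> lin f3 ->
    P (fun x => f1 x * f2 x * f3 x).
  move=> [a1 h1] [a2 h2] [a3 h3].
  have -> : (fun x => f1 x * f2 x * f3 x) = (fun x => \sum_i \sum_j \sum_k
      a1 i * (a2 j * (a3 k * (bary i x * bary j x * bary k x)))).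
    apply/funext => x; rewrite h1 h2 h3 !mulr_suml; apply: eq_bigr => i _.
    rewrite -mulrA mulr_suml mulr_sumr; apply: eq_bigr => j _.
    by rewrite mulrA mulr_sumr; apply: eq_bigr => k _; ring.
  apply: (Psum) => i; apply: (Psum) => j; apply: (Psum) => k.
  exact: (PZ _ _ (PZ _ _ (PZ _ _ (P3 _ _ _)))).
have l1 : lin (fun=> 1).
  exists (fun=> 1) => x; rewrite -[LHS](sum_bary vtx x).
  by apply: eq_bigr => i _; rewrite mul1r.
have lx j : lin (fun x : plane => x 0 j).
  by exists (fun i => vtx i 0 j) => x; rewrite -coord_bary.
apply: poly_on_ind pf => // a b ab.
(* a factors x_0, then b factors x_1, padded with ones to three factors *)
pose F l (x : plane) :=
  if (l < a)%N then x 0 0 else if (l < a + b)%N then x 0 1 else 1.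
have -> : (fun x : plane => x 0 0 ^+ a * x 0 1 ^+ b) =
    (fun x => F 0%N x * F 1%N x * F 2%N x).
  apply/funext => x; rewrite /F {F}.
  by move: a b ab => [|[|[|[|//]]]] [|[|[|[|//]]]] //= _; ring.
by apply: Plin; rewrite /F; case: (_ < a)%N; case: (_ < a + b)%N.
Qed.

Lemma poly_on_hermite A d c :
  poly_on A 3 (fun x => hermite_cubic d x + c * bubble x).
Proof.
have b i := poly_on_bary A i.
apply: poly_onD.
  apply: poly_on_sum => i; apply: poly_on_sum => j; apply: poly_onZ.
  exact: poly_onM (poly_onM (b i) (b i)) (b j).
by apply: poly_onZ; exact: poly_onM (poly_onM (b _) (b _)) (b _).
Qed.

End PolyBary.

(** * The functions w_i *)

Section Hct.
Context {R : realType}.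
Notation plane := 'rV[R]_2.
Variable vtx : 'I_3 -> plane.
Local Notation bary := (bary vtx).
Local Notation bary_form := (bary_form vtx).
Local Notation bubble := (bubble vtx).

Definition min_bary x : R :=
  Num.min (bary 0 x) (Num.min (bary 1 x) (bary (1 + 1) x)).

Lemma min_baryP x : exists2 j, min_bary x = bary j x &
  forall i, bary j x <= bary i x.
Proof.
have all3 (P : 'I_3 -> Prop) : P 0 -> P 1 -> P (1 + 1) -> forall i, P i.
  move=> P0 P1 P2 i; have [->|->|->] := cyc_case 0 i => //.
    by rewrite (_ : 0 + 1 = 1) //; apply/val_inj.
  by rewrite (_ : 0 - 1 = 1 + 1) //; apply/val_inj.
rewrite /min_bary; case: (leP (bary 1 x)) => h1; case: (leP (bary 0 x)) => h2.
- by exists 0 => //; apply: all3 => //; exact: le_trans h1.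
- by exists 1 => //; apply: all3 => //; exact: ltW.
- by exists 0 => //; apply: all3 => //; apply: (le_trans h2); exact: ltW.
- by exists (1 + 1) => //; apply: all3 => //; exact: ltW.
Qed.

Lemma min_bary_le i x : min_bary x <= bary i x.
Proof. by have [j ->] := min_baryP x. Qed.

(** The cofactor of - 2 m in
    (lambda_(i+1) - m)^2 (lambda_i - lambda_(i-1))
    + (lambda_(i-1) - m)^2 (lambda_i - lambda_(i+1)), which is the combination
    of squared refined hat functions in 8 c_ii w_i. *)
Definition pair_form i x :=
  bary i x * (bary (i + 1) x + bary (i - 1) x)
  - 2 * (bary (i + 1) x * bary (i - 1) x).

(** The function c_ii w_i after the substitution of lambda_j - m for the refined
    hat functions; it is a piecewise cubic Hsieh-Clough-Tocher function. *)
Definition hct i x : R :=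
  8^-1 * (min_bary x ^+ 2 * (2 * bary i x - bary (i + 1) x - bary (i - 1) x)
          - 2 * (min_bary x * pair_form i x) + 4 * bubble x).

Lemma sum_hct x : \sum_i hct i x = 3 / 2 * bubble x.
Proof.
rewrite (sum_cyc 0) /hct /pair_form.
rewrite ?cyc_succ2 ?cyc_succK ?cyc_predK ?cyc_pred2.
by rewrite /bubble; field.
Qed.

Hypothesis hT : nondegenerate_triangle vtx.
Local Notation T := (triangle vtx).

Lemma min_bary_ge0 x : T x -> 0 <= min_bary x.
Proof. by move=> Tx; have [j -> _] := min_baryP x; exact: triangle_ge0. Qed.

Lemma min_bary_edge k x : T x -> bary k x = 0 -> min_bary x = 0.
Proof.
by move=> Tx xk; apply/eqP; rewrite eq_le min_bary_ge0 // andbT -xk min_bary_le.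
Qed.

Definition edge_bump k x := bary (k + 1) x * bary (k - 1) x.

(** The minimum m is not differentiable where two coordinates tie.  Near a
    point [x] of the edge e_k it can differ from lambda_k only where another
    coordinate is at most lambda_k, hence small, and then the same coordinate is
    small at [x] and so is the edge bump there.  A factor that is a multiple of
    the edge bump at [x] thus makes the error quadratic. *)
Lemma has_diff_min k x q L c : T x -> bary k x = 0 ->
  has_diff T x q L -> q x = c * edge_bump k x ->
  has_diff T x (fun y => min_bary y * q y) (fun h => q x * bary_form k h).
Proof.
move=> Tx xk dq qx.
have [K K0 hK] := has_diff_lip dq.
have lipb i := has_diff_lip (has_diff_bary vtx x i).
have [K1 K10 hK1] := lipb (k + 1); have [K2 K20 hK2] := lipb (k - 1).
have [K3 K30 hK3] := lipb k.
have mx := min_bary_edge Tx xk.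
split; first by move=> a h h'; rewrite linear_bary_form; ring.
(* The factor K3 bounds lambda_k - m, and K1 + K3 or K2 + K3 the coordinate at
   x that belongs to the smallest coordinate at y. *)
exists (K3 * K + `|c| * (K3 * (K1 + K3) + K3 * (K2 + K3))) => y Ty y1.
rewrite mx mul0r subr0 -bary_sub xk subr0.
have m0 := min_bary_ge0 Ty.
have mk := min_bary_le k y.
set z := `|y - x|; have z0 : 0 <= z by exact: normr_ge0.
have k0 := triangle_ge0 hT k Ty.
have kz : bary k y <= K3 * z by have := hK3 _ Ty y1; rewrite xk subr0 ger0_norm.
have -> : min_bary y * q y - q x * bary k y =
  min_bary y * (q y - q x) - c * ((bary k y - min_bary y) * edge_bump k x).
  by rewrite qx; ring.
rewrite (le_trans (ler_normB _ _)) // [leRHS]mulrDl lerD //.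
  rewrite normrM (ger0_norm m0).
  rewrite (_ : _ * _ ^+ 2 = (K3 * z) * (K * z)); last by ring.
  by rewrite ler_pM // ?hK // (le_trans mk).
rewrite normrM -mulrA ler_wpM2l // [leRHS]mulrDl.
have p0 := triangle_ge0 hT (k + 1) Tx; have q0 := triangle_ge0 hT (k - 1) Tx.
have p1 : bary (k + 1) x <= 1.
  by have := sum_bary vtx x; rewrite (sum_cyc k) xk; lra.
have q1 : bary (k - 1) x <= 1.
  by have := sum_bary vtx x; rewrite (sum_cyc k) xk; lra.
have bump0 : 0 <= edge_bump k x by rewrite mulr_ge0.
rewrite ger0_norm ?mulr_ge0 ?subr_ge0 //.
have bound l K' b : 0 <= b -> b <= 1 -> bary l y <= bary k y ->
    `|bary l y - bary l x| <= K' * z ->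
    (bary k y - bary l y) * (bary l x * b) <= K3 * (K' + K3) * z ^+ 2.
  move=> b0 b1 lk; rewrite distrC => /(le_trans (ler_norm _)) hl.
  rewrite (_ : _ * _ ^+ 2 = (K3 * z) * ((K' + K3) * z)); last by ring.
  have lx0 := triangle_ge0 hT l Tx; have ly0 := triangle_ge0 hT l Ty.
  rewrite ler_pM ?mulr_ge0 ?subr_ge0 //; first by lra.
  by rewrite (le_trans (ler_piMr lx0 b1)) //; lra.
have r0 K' : 0 <= K' -> 0 <= K3 * (K' + K3) * z ^+ 2.
  by move=> K'0; rewrite !mulr_ge0 ?addr_ge0 ?exprn_ge0.
have [j mj jle] := min_baryP y; rewrite mj /edge_bump.
case: (cyc_case k j) => jE; rewrite {j}jE in mj jle *.
- by rewrite subrr mul0r addr_ge0 ?r0.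
- rewrite -[leLHS]addr0 lerD ?r0 // bound //.
  exact: hK1.
- rewrite -[leLHS]add0r lerD ?r0 // [bary (k + 1) x * _]mulrC bound //.
  exact: hK2.
Qed.

End Hct.

(** * Splines and their vertex data *)

Section Spline.
Context {R : realType}.
Notation plane := 'rV[R]_2.
Variable vtx : 'I_3 -> plane.
Local Notation bary := (bary vtx).
Local Notation bary_form := (bary_form vtx).
Local Notation bubble := (bubble vtx).
Local Notation min_bary := (min_bary vtx).
Local Notation pair_form := (pair_form vtx).
Local Notation hct := (hct vtx).
Local Notation edge_bump := (edge_bump vtx).
Local Notation hermite_cubic := (hermite_cubic vtx).
Hypothesis hT : nondegenerate_triangle vtx.
Local Notation T := (triangle vtx).

Lemma has_diff_min_sq k x : T x -> bary k x = 0 ->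
  has_diff T x (fun y => min_bary y ^+ 2) (fun=> 0).
Proof.
move=> Tx xk; have [K K0 hK] := has_diff_lip (has_diff_bary vtx x k).
split=> [a h h'|]; first by rewrite mulr0 addr0.
exists (K ^+ 2) => y Ty y1.
rewrite (min_bary_edge hT Tx xk).
rewrite expr0n subr0 subr0 normrX -exprMn ler_pXn2r ?nnegrE ?mulr_ge0 //.
have m0 := min_bary_ge0 hT Ty.
rewrite ger0_norm // (le_trans (min_bary_le _ k y)) //.
by have := hK _ Ty y1; rewrite xk subr0; apply: le_trans; rewrite ler_norm.
Qed.

Lemma pair_form_edge k i x : bary k x = 0 ->
  pair_form i x = (if i == k then -2 else 1) * edge_bump k x.
Proof.
move=> xk; rewrite /pair_form /edge_bump.
case: (cyc_case k i) => ->;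
  rewrite ?eqxx ?cyc_eqF ?cyc_succ2 ?cyc_succK ?cyc_predK ?cyc_pred2 ?xk; ring.
Qed.

Lemma has_diff_bubble k x : T x -> bary k x = 0 ->
  has_diff T x bubble (fun h => edge_bump k x * bary_form k h).
Proof.
move=> Tx xk.
have d := has_diffM (has_diff_bary vtx x k)
  (has_diffM (has_diff_bary vtx x (k + 1)) (has_diff_bary vtx x (k - 1))).
apply: has_diff_eq d => // [y _|h]; first by rewrite (bubbleE _ k).
by rewrite xk mul0r add0r.
Qed.

(** The square of m is negligible at an edge, and m times [pair_form] behaves
    like lambda_k times the value of [pair_form] at [x], which is -2 or 1 times
    the edge bump.  This leaves (4 + 4) / 8 = 1 if i = k and (4 - 2) / 8 = 1/4
    otherwise. *)
Lemma has_diff_hct k i x : T x -> bary k x = 0 ->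
  has_diff T x (hct i)
    (fun h => (if i == k then 1 else 4^-1) * (edge_bump k x * bary_form k h)).
Proof.
move=> Tx xk.
have b j := has_diff_bary vtx x j.
have bN j := has_diffZ (-1) (b j).
have dlev :=
  has_diffD (has_diffD (has_diffZ 2 (b i)) (bN (i + 1))) (bN (i - 1)).
have dpair := has_diffD (has_diffM (b i) (has_diffD (b (i + 1)) (b (i - 1))))
  (has_diffZ (-2) (has_diffM (b (i + 1)) (b (i - 1)))).
have pE : bary i x * (bary (i + 1) x + bary (i - 1) x) +
   -2 * (bary (i + 1) x * bary (i - 1) x) = pair_form i x.
  by rewrite /pair_form; ring.
have dmin := has_diff_min hT Tx xk dpair
  (etrans pE (pair_form_edge i xk)).
have d := has_diffZ 8^-1 (has_diffD (has_diffD
  (has_diffM (has_diff_min_sq Tx xk) dlev) (has_diffZ (-2) dmin))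
  (has_diffZ 4 (has_diff_bubble Tx xk))).
apply: has_diff_eq d => // [y _|h].
  by rewrite /hct /pair_form; ring.
rewrite (min_bary_edge hT Tx xk) expr0n pE (pair_form_edge i xk) /=.
by case: ifP => _; field.
Qed.

Definition hermite_diff d x h : R :=
  \sum_i \sum_j d i j * (2 * bary i x * bary j x * bary_form i h
                         + bary i x ^+ 2 * bary_form j h).

Lemma has_diff_hermite d x : T x ->
  has_diff T x (hermite_cubic d) (hermite_diff d x).
Proof.
move=> Tx; apply: has_diff_sum => i; apply: has_diff_sum => j.
apply: has_diffZ; have b l := has_diff_bary vtx x l.
apply: has_diff_eq (has_diffM (has_diffM (b i) (b i)) (b j)) => // h.
by ring.
Qed.

Definition spline d c (a : 'I_3 -> R) x : R :=
  hermite_cubic d x + c * bubble x + \sum_i a i * hct i x.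

(** What b and the functions c_ii w_i contribute to the edge bump in the
    differential along e_k: c + a_k + (1/4) sum_(i <> k) a_i. *)
Definition bump_coef c (a : 'I_3 -> R) k : R :=
  c + (3 * a k + \sum_i a i) / 4.

Lemma grad_spline d c a u k x h : (forall y, T y -> u y = spline d c a y) ->
  T x -> bary k x = 0 ->
  dot (grad T u x) h =
  hermite_diff d x h + bump_coef c a k * (edge_bump k x * bary_form k h).
Proof.
move=> uE Tx xk.
pose L h' := hermite_diff d x h'
  + bump_coef c a k * (edge_bump k x * bary_form k h').
rewrite -/(L h); apply: grad_triangle => //.
have ds := has_diffD (has_diffD (has_diff_hermite d Tx)
   (has_diffZ c (has_diff_bubble Tx xk)))
   (has_diff_sum (fun i => has_diffZ (a i) (has_diff_hct i Tx xk))).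
apply: has_diff_eq ds => // [y Ty|h'] /=; first by rewrite uE.
by rewrite /L /bump_coef !(sum_cyc k) eqxx !cyc_eqF; field.
Qed.

Lemma spline_vtx d c a i : spline d c a (vtx i) = d i i.
Proof.
have v j := bary_vtx hT j i.
have m0 : min_bary (vtx i) = 0.
  by apply: (min_bary_edge hT (k := i + 1));
    [exact: vtx_triangle|rewrite v cyc_eqF].
have b0 : bubble (vtx i) = 0.
  by rewrite (bubbleE _ i) !v eqxx !cyc_eqF !natbE; ring.
rewrite /spline b0 /hct m0 b0 big1 => [|j _]; last by ring.
by rewrite /hermite_cubic !(sum_cyc i) !v eqxx !cyc_eqF !natbE; ring.
Qed.

Lemma edge_bump_vtx k i : edge_bump k (vtx i) = 0.
Proof.
rewrite /edge_bump !bary_vtx // -natrM mulnb.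
by case: eqP => //= <-; rewrite cyc_eqF.
Qed.

Lemma hermite_diff_vtx d i h :
  hermite_diff d (vtx i) h =
  2 * d i i * bary_form i h + \sum_j d i j * bary_form j h.
Proof.
rewrite /hermite_diff !(sum_cyc i) !(bary_vtx hT) eqxx !cyc_eqF !natbE; ring.
Qed.

Lemma hermite_diff_vtxE d i k : k != i ->
  hermite_diff d (vtx i) (vtx k - vtx i) = d i k - 3 * d i i.
Proof.
rewrite hermite_diff_vtx (sum_cyc i) !(bary_form_vtx hT).
case: (cyc_case i k) => ->; rewrite ?eqxx ?cyc_eqF // => _;
  by rewrite !natbE; ring.
Qed.

(** The solution [d] of [hermite_diff_vtxE] for given vertex values and
    derivatives along the edges. *)
Definition hermite_coef (a : 'I_3 * option 'I_2 -> R) i j : R :=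
  if j == i then a (i, None)
  else 3 * a (i, None) +
       \sum_(l < 2) a (i, Some l) * (vtx j - vtx i) 0 l.

Lemma grad_spline_vtx d c a u i h : (forall y, T y -> u y = spline d c a y) ->
  dot (grad T u (vtx i)) h = hermite_diff d (vtx i) h.
Proof.
move=> uE; rewrite (grad_spline (k := i + 1) h uE).
- by rewrite edge_bump_vtx mul0r mulr0 addr0.
- exact: vtx_triangle.
- by rewrite bary_vtx // cyc_eqF.
Qed.

(** The coefficients [d] and the vertex data determine each other since the
    vectors v_k - v_i span the plane and d_ik - 3 d_ii is the derivative at v_i
    along v_k - v_i. *)
Lemma spline_dofP d c a u (b : 'I_3 * option 'I_2 -> R) :
  (forall y, T y -> u y = spline d c a y) ->
  (forall k, vertex_dof vtx k u = b k) <->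
  (forall i j, d i j = hermite_coef b i j).
Proof.
move=> uE; have u_vtx i : u (vtx i) = d i i.
  by rewrite uE ?spline_vtx //; exact: vtx_triangle.
split=> [ub i j|dE [i [l|]]].
- rewrite /hermite_coef; case: eqVneq => [->|ji].
    by rewrite -ub -u_vtx.
  have := hermite_diff_vtxE d ji; rewrite -(grad_spline_vtx i _ uE).
  rewrite -ub /vertex_dof /= u_vtx => e.
  have -> : d i j = 3 * d i i + (d i j - 3 * d i i) by ring.
  rewrite -e; congr (_ + _); apply: eq_bigr => l _.
  by have := ub (i, Some l); rewrite /vertex_dof /= => ->.
- rewrite /vertex_dof /=.
  pose h : plane := delta_mx 0 l.
  have -> : grad T u (vtx i) 0 l = dot (grad T u (vtx i)) h.
    rewrite /dot (bigD1 l) //= big1 ?addr0 => [|j jl];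
      rewrite !mxE ?eqxx ?mulr1 //.
    by rewrite (negPf jl) mulr0.
  rewrite (grad_spline_vtx i _ uE) hermite_diff_vtx.
  pose G (v : plane) := \sum_(l < 2) b (i, Some l) * v 0 l.
  have lG : linear_form G.
    move=> t v w; rewrite /G mulr_sumr -big_split; apply: eq_bigr => j _ /=.
    by rewrite !mxE; ring.
  have -> : b (i, Some l) = G h.
    rewrite /G (bigD1 l) //= big1 ?addr0 => [|j jl];
      rewrite !mxE ?eqxx ?mulr1 //.
    by rewrite (negPf jl) mulr0.
  rewrite -[in RHS](bary_form_reproduce hT h) linear_form_sum //.
  have s0 := sum_bary_form vtx h; move: s0.
  rewrite !(sum_cyc i) !dE /hermite_coef !eqxx !cyc_eqF => s0.
  have Gv j : \sum_(l0 < 2) b (i, Some l0) * (vtx j - vtx i) 0 l0 =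
      G (vtx j) - G (vtx i).
    by rewrite -/(G (vtx j - vtx i)) linear_formB.
  rewrite !Gv.
  have -> : bary_form i h = - bary_form (i + 1) h - bary_form (i - 1) h by lra.
  by ring.
- by rewrite /vertex_dof /= u_vtx dE /hermite_coef eqxx.
Qed.

End Spline.

(** * Normal derivatives and the space U_2 *)

Section EdgeConditions.
Context {R : realType}.
Notation plane := 'rV[R]_2.
Variable vtx : 'I_3 -> plane.
Hypothesis hT : nondegenerate_triangle vtx.
Local Notation bary := (bary vtx).
Local Notation bary_form := (bary_form vtx).
Local Notation bubble := (bubble vtx).
Local Notation min_bary := (min_bary vtx).
Local Notation hct := (hct vtx).
Local Notation edge_bump := (edge_bump vtx).
Local Notation hermite_diff := (hermite_diff vtx).
Local Notation spline := (spline vtx).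
Local Notation T := (triangle vtx).

Lemma barycentricE lam i x : barycentric vtx lam -> T x -> lam i x = bary i x.
Proof.
move=> /(_ i) [/(poly_on1_bary hT) [a lamE] lam_vtx] Tx; rewrite lamE //.
rewrite (sum_cyc i) -!(sum_scale_bary hT a).
rewrite -!lamE ?lam_vtx; try exact: vtx_triangle.
by rewrite eqxx !cyc_eqF !natbE; ring.
Qed.

(** On T_j the refined hat function is the affine function with the values
    prescribed at the vertices of T_j, and lambda_i - lambda_j is such a
    function (it is 0 if i = j). *)
Lemma refined_hatE lamR i x : refined_hat vtx lamR -> T x ->
  lamR i x = bary i x - min_bary x.
Proof.
move=> /(_ i) [_ hpoly hc hv] Tx.
have [j -> jle] := min_baryP vtx x.
have [a lamRE] := poly_on1_bary hT (hpoly j).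
have mem_vtx l : l != j -> a l = (i == l)%:R.
  move=> lj; rewrite -hv lamRE ?(sum_scale_bary hT) //.
  by apply: conv_hull_sub; right; exists l.
have a_c : a j + a (j + 1) + a (j - 1) = 0.
  have := hc; rewrite lamRE; last by apply: conv_hull_sub; left.
  by rewrite (sum_cyc j) !(bary_barycenter hT) => e; lra.
rewrite lamRE; last exact: subtriangle_mem.
move: a_c; rewrite (sum_cyc j).
rewrite (mem_vtx (j + 1)) ?(mem_vtx (j - 1)) ?cyc_eqF // => a_c.
have -> : a j = - (i == j + 1)%:R - (i == j - 1)%:R by lra.
case: (cyc_case j i) => ->; rewrite ?eqxx !cyc_eqF !natbE; ring.
Qed.

Lemma C_T_neq0 : C_T vtx != 0.
Proof.
have det0 : \det (edge_mx vtx) != 0.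
  by have := edge_mx_unit hT; rewrite unitmxE unitfE.
rewrite /C_T /area !(mulf_eq0, invr_eq0, expf_eq0, normr_eq0, pnatr_eq0).
by rewrite negb_or (negPf det0).
Qed.

Variables (n : 'I_3 -> plane) (lam lamR : 'I_3 -> plane -> R).
Hypothesis hn : forall i, unit_normal vtx i (n i).
Hypothesis hlam : barycentric vtx lam.
Hypothesis hlamR : refined_hat vtx lamR.
Local Notation nu k := (bary_form k (n k)).

Lemma c_diagE i : c_diag vtx n lam i = nu i.
Proof.
apply: (grad_triangle hT) (barycenter_triangle hT) _.
apply: has_diff_eq (has_diff_bary vtx _ i) => //.
  exact: barycenter_triangle.
by move=> y Ty; rewrite barycentricE.
Qed.

Lemma w_funE i x : T x -> w_fun vtx n lam lamR i x = (nu i)^-1 * hct i x.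
Proof.
move=> Tx; rewrite /w_fun /v_fun c_diagE.
have neq0 := unit_normal_neq0 hT (hn i); have CT0 := C_T_neq0.
have bE := bubbleE vtx i x.
rewrite !cyc_succ2 !cyc_predK !cyc_succK !cyc_pred2 eqxx !cyc_eqF.
rewrite !(refined_hatE _ hlamR Tx) !(barycentricE _ hlam Tx).
rewrite /hct /pair_form.
have -> b : C_T vtx * bary 0 x * bary 1 x * b =
    C_T vtx * (bary 0 x * bary 1 x * b) by rewrite !mulrA.
rewrite -/(bubble x) bE.
by field; rewrite neq0.
Qed.

(** The coefficient of the edge bump lambda_(k+1) lambda_(k-1) in the normal
    derivative of the cubic [hermite_cubic d] on e_k, after subtracting the
    affine interpolant of its values at the two end points. *)
Definition edge_defect (d : 'I_3 -> 'I_3 -> R) k : R :=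
  2 * (d (k + 1) (k - 1) * bary_form (k + 1) (n k)
       + d (k - 1) (k + 1) * bary_form (k - 1) (n k))
  - hermite_diff d (vtx (k + 1)) (n k) - hermite_diff d (vtx (k - 1)) (n k).

Lemma hermite_diff_edge d k x : bary k x = 0 ->
  hermite_diff d x (n k) =
  hermite_diff d (vtx (k + 1)) (n k) * bary (k + 1) x
  + hermite_diff d (vtx (k - 1)) (n k) * bary (k - 1) x
  + edge_defect d k * edge_bump k x.
Proof.
move=> xk; rewrite /edge_defect !(hermite_diff_vtx hT) /edge_bump.
have s1 := sum_bary vtx x; rewrite (sum_cyc k) xk add0r in s1.
rewrite /hermite_diff !(sum_cyc k) xk.
have -> : bary (k - 1) x = 1 - bary (k + 1) x by lra.
by ring.
Qed.

(** The edge bump vanishes at both end points but not at the midpoint. *)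
Lemma poly_on_edgeP k (a b c : R) :
  poly_on (opp_edge vtx k) 1
    (fun x => a * bary (k + 1) x + b * bary (k - 1) x + c * edge_bump k x)
  <-> c = 0.
Proof.
split=> [/(poly_on1_bary hT) [e eE]|->]; last first.
  apply: (@poly_on_eq _ _ _
    (fun x => a * bary (k + 1) x + b * bary (k - 1) x)).
    by move=> x _; rewrite mul0r addr0.
  by apply: poly_onD; apply: poly_onZ; exact: poly_on_bary.
have in_edge j : j != k -> opp_edge vtx k (vtx j).
  by move=> jk; apply: conv_hull_sub; exists j.
have e1 := eE _ (in_edge (k + 1) _); have e2 := eE _ (in_edge (k - 1) _).
pose m := 2^-1 *: vtx (k + 1) + (1 - 2^-1) *: vtx (k - 1).
have em : opp_edge vtx k m.
  apply: conv_hull_seg; first by apply/andP; split; lra.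
    by apply: in_edge; rewrite cyc_eqF.
  by apply: in_edge; rewrite cyc_eqF.
have e3 := eE _ em; move: e1 e2 e3.
rewrite !(sum_cyc k) /edge_bump !bary_conv !(bary_vtx hT) !eqxx !cyc_eqF !natbE.
by move=> /(_ isT) h1 /(_ isT) h2 h3; lra.
Qed.

Lemma normal_derivP d c a u k : (forall y, T y -> u y = spline d c a y) ->
  poly_on (opp_edge vtx k) 1 (fun x => dot (grad T u x) (n k))
  <-> edge_defect d k + bump_coef c a k * nu k = 0.
Proof.
move=> uE; rewrite -(poly_on_edgeP k (hermite_diff d (vtx (k + 1)) (n k))
  (hermite_diff d (vtx (k - 1)) (n k))).
have gE x : opp_edge vtx k x -> dot (grad T u x) (n k) =
  hermite_diff d (vtx (k + 1)) (n k) * bary (k + 1) x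
  + hermite_diff d (vtx (k - 1)) (n k) * bary (k - 1) x
  + (edge_defect d k + bump_coef c a k * nu k) * edge_bump k x.
  rewrite opp_edgeE // => -[Tx xk].
  by rewrite (grad_spline hT (n k) uE Tx xk) (hermite_diff_edge d xk); ring.
by split; apply: poly_on_eq => x /gE.
Qed.

Lemma U2P u : U2 vtx n lam lamR u <-> exists d c a,
  (forall y, T y -> u y = spline d c a y) /\
  forall k, edge_defect d k + bump_coef c a k * nu k = 0.
Proof.
split=> [[[p [a [/(poly_on3_bary hT) [d [c pE]] uE]]] hu]|[d [c [a [uE hu]]]]].
  have uE' y : T y -> u y = spline d c (fun i => a i / nu i) y.
    move=> Ty; rewrite uE // pE // /spline; congr (_ + _).
    apply: eq_bigr => i _.
    by rewrite w_funE // mulrA.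
  exists d, c, (fun i => a i / nu i); split=> // k.
  by apply/(normal_derivP k uE').
split; last by move=> k; apply/(normal_derivP k uE).
exists (fun x => hermite_cubic vtx d x + c * bubble x), (fun i => a i * nu i).
split; first exact: poly_on_hermite.
move=> x Tx; rewrite uE // /spline; congr (_ + _); apply: eq_bigr => i _.
by rewrite w_funE //; field; exact: (unit_normal_neq0 hT).
Qed.

End EdgeConditions.

(** * Unisolvence *)

Theorem lemma3p6 (R : realType) (vtx n : 'I_3 -> 'rV[R]_2)
    (lam lamR : 'I_3 -> 'rV[R]_2 -> R)
    (hT : nondegenerate_triangle vtx)
    (hn : forall i : 'I_3, unit_normal vtx i (n i))
    (hlam : barycentric vtx lam)
    (hlamR : refined_hat vtx lamR) :
  unisolvent (triangle vtx) (U2 vtx n lam lamR) (vertex_dof vtx).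
Proof.
move=> b; pose d := hermite_coef vtx b.
pose r k := - edge_defect vtx n d k / bary_form vtx k (n k).
have edge_eqP c a k :
    edge_defect vtx n d k + bump_coef c a k * bary_form vtx k (n k) = 0 <->
    bump_coef c a k = r k.
  have nk := unit_normal_neq0 hT (hn k).
  split=> [e|->]; last by rewrite /r; field.
  have dE : edge_defect vtx n d k =
    - (bump_coef c a k * bary_form vtx k (n k)) by lra.
  by rewrite /r dE opprK mulfK.
(* The solution with sum_i a_i = - 4 c, for which the equations decouple. *)
pose c0 := - (\sum_k r k) / 3; pose a0 k := 4 / 3 * r k.
have sol0 k : bump_coef c0 a0 k = r k.
  by rewrite /bump_coef /c0 /a0 -mulr_sumr; field.
exists (spline vtx d c0 a0); split.
- apply/(U2P hT hn hlam hlamR); exists d, c0, a0; split=> // k.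
  exact/edge_eqP.
- by apply/(spline_dofP hT b (u := spline vtx d c0 a0) (d := d) (c := c0)
    (a := a0)).
move=> u' /(U2P hT hn hlam hlamR) [d' [c [a [uE sol]]]].
move=> /(spline_dofP hT b uE) d'E x Tx.
have dE : d' = d by apply/funext => i; apply/funext => j; rewrite d'E.
rewrite uE //; move: sol; rewrite dE => sol.
have {}sol k : bump_coef c a k = r k by apply/edge_eqP.
(* Any other solution differs from this one by t in each a_i. *)
pose t := - (c + (\sum_i a i) / 4) * (4 / 3).
have aE i : a i = a0 i + t.
  by rewrite /a0 -sol /bump_coef /t; field.
have tE : c = c0 - 3 / 2 * t.
  have : \sum_i a i = \sum_i a0 i + 3 * t.
    by rewrite !(sum_cyc 0) !aE; ring.
  have : \sum_i a0 i = 4 / 3 * \sum_i r i by rewrite mulr_sumr.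
  by rewrite /c0 /t => h1 h2; lra.
have hE i : a i * hct vtx i x = a0 i * hct vtx i x + t * hct vtx i x.
  by rewrite aE mulrDl.
rewrite /spline (eq_bigr _ (fun i _ => hE i)).
by rewrite big_split -mulr_sumr sum_hct tE /=; field.
Qed.
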